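(* The ML estimate of $\alpha_{t}$ from the observation $z_k = z_{k,\Re} + \jmath z_{k,\Im}$ (with $z_{k,\Re}, z_{k,\Im} \in \mathbb{R}$) is \begin{equation} \hat{\alpha}_{t,k}^{\text{ML}} = \arg\max_{\alpha \geq \rho_k \beta_k \tau_p} \; f_1 \left( z_{k,\Re} | \alpha \right) f_2 \left( z_{k,\Im} | \alpha \right) \end{equation} for the conditional PDFs \begin{align} &f_1 \left( z_{k,\Re} | \alpha \right) = \frac{ e^{- \frac{(z_{k,\Re})^2}{\lambda_2} \left( 1 - \frac{\lambda_1}{\lambda_1 + \lambda_2} \right)} }{\Gamma(M) \lambda_1^M \sqrt{\pi \lambda_2 }} \sum_{n=0}^{2M-1} {2M-1 \choose n} \notag \\ & \times \frac{\left( \Gamma \left( \frac{n+1}{2} \right) + c_n(z_{k,\Re}) \gamma \left( \frac{n+1}{2} , \frac{(z_{k,\Re})^2}{\lambda_2} \frac{\lambda_1}{\lambda_1+\lambda_2} \right) \right) }{ \left( \frac{z_{k,\Re}}{\lambda_2} \right)^{n+1-2M} \left( \frac{1}{\lambda_1} + \frac{1}{\lambda_2} \right)^{2M-\frac{n+1}{2}} }, \\ &f_2 \left( z_{k,\Im} | \alpha \right) = \frac{1}{\sqrt{\pi \lambda_2 }} e^{- \frac{( z_{k,\Im} )^2 }{\lambda_2} }, \end{align} where $\gamma(\cdot,\cdot)$ is the lower incomplete gamma function, $c_n(z)=(-1)^n$ if $z\ge 0$ and $c_n(z)=-1$ if $z<0$, and \begin{align} \lambda_1 &= \frac{\rho_k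 q \beta_k^2 \tau_p^2}{\alpha + \sigma^2}, \qquad \lambda_2 = \sigma^2 + \Upsilon_k + q \beta_k \tau_p - \lambda_1. \end{align}
   Context: A BS with $M$ antennas; $\tau_p$ orthogonal uplink pilots $\boldsymbol{\psi}_t$ with $\|\boldsymbol{\psi}_t\|^2=\tau_p$; $\mathcal{S}_t$ is the set of UEs sending pilot $t$, UE $i$ using power $\rho_i>0$. Uncorrelated Rayleigh fading $\mathbf{h}_k\sim\mathcal{CN}(\mathbf{0},\beta_k\mathbf{I}_M)$, independent across UEs, with $\beta_k$ known to UE $k$. The BS obtains $\mathbf{y}_t=\sum_{i\in\mathcal{S}_t}\sqrt{\rho_i\tau_p}\,\mathbf{h}_i+(\text{inter-cell interference of per-antenna power }\omega_t)+\mathbf{n}_t$, $\mathbf{n}_t\sim\mathcal{CN}(\mathbf{0},\sigma^2\mathbf{I}_M)$, and $\alpha_t=\sum_{i\in\mathcal{S}_t}\rho_i\beta_i\tau_p+\omega_t$. It transmits $\mathbf{V}=\sqrt{q}\sum_t\frac{\mathbf{y}_t^*}{\|\mathbf{y}_t\|}\boldsymbol{\phi}_t^{\mathrm{T}}$ with orthogonal $\boldsymbol{\phi}_t$, $\|\boldsymbol{\phi}_t\|^2=\tau_p$. UE $k\in\mathcal{S}_t$ observes $z_k=\sqrt{q\tau_p}\,\mathbf{h}_k^{\mathrm{T}}\frac{\mathbf{y}_t^*}{\|\mathbf{y}_t\|}+\boldsymbol{\upsilon}_k^{\mathrm{T}}\frac{\boldsymbol{\phi}_t^*}{\|\boldsymbol{\phi}_t\|}+\eta_k$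 with $\boldsymbol{\upsilon}_k\sim\mathcal{CN}(\mathbf{0},\Upsilon_k\mathbf{I}_{\tau_p})$ independent inter-cell interference and $\eta_k\sim\mathcal{CN}(0,\sigma^2)$. Then $z_k=g_k+\nu_k$ with independent $g_k=\sqrt{\lambda_1/2}\,x$, $x\sim\chi_{2M}$, and $\nu_k\sim\mathcal{CN}(0,\lambda_2)$ (with $\alpha=\alpha_t$). UE $k$ knows $\alpha_t\ge\rho_k\beta_k\tau_p$. *)

(* Defs.v *)
From HB Require Import structures.
From mathcomp Require Import all_boot all_order all_algebra.
From mathcomp Require Import all_classical all_reals all_analysis.
Set Implicit Arguments. Unset Strict Implicit. Unset Printing Implicit Defensive.
Import Order.TTheory GRing.Theory Num.Theory.
Import numFieldNormedType.Exports.
Local Open Scope classical_set_scope.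
Local Open Scope ring_scope.

Definition Gamma_fn {R : realType} (s : R) : R :=
  fine (\int[@lebesgue_measure R]_(t in [set t : R | (0 < t)%R]) (powR t (s - 1) * expR (- t))%:E)%E.

Definition lower_gamma {R : realType} (s x : R) : R :=
  fine (\int[@lebesgue_measure R]_(t in [set t : R | (0 < t <= x)%R]) (powR t (s - 1) * expR (- t))%:E)%E.

Definition chi_pdf {R : realType} (k : nat) (x : R) : R :=
  if 0 <= x then
    x ^+ k.-1 * expR (- (x ^+ 2) / 2) / (powR 2 (k%:R / 2 - 1) * Gamma_fn (k%:R / 2))
  else 0.

Definition c_sign {R : realType} (n : nat) (z : R) : R :=
  if 0 <= z then (-1) ^+ n else -1.

Definition lambda1 {R : realType} (rho q beta : R) (tau : nat) (sigma2 alpha : R) : R :=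
  rho * q * beta ^+ 2 * (tau%:R) ^+ 2 / (alpha + sigma2).

Definition lambda2 {R : realType} (rho q beta : R) (tau : nat) (sigma2 Ups alpha : R) : R :=
  sigma2 + Ups + q * beta * tau%:R - lambda1 rho q beta tau sigma2 alpha.

Definition f1 {R : realType} (M : nat) (l1 l2 z : R) : R :=
  expR (- (z ^+ 2) / l2 * (1 - l1 / (l1 + l2)))
    / (Gamma_fn (M%:R) * l1 ^+ M * Num.sqrt (pi * l2))
  * \sum_(n < (2 * M)%N)
      ('C((2 * M).-1, n)%:R
       * (Gamma_fn ((n%:R + 1) / 2)
          + c_sign n z * lower_gamma ((n%:R + 1) / 2) (z ^+ 2 / l2 * (l1 / (l1 + l2))))
       / ((z / l2) ^ ((n.+1)%:Z - (2 * M)%:Z)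
          * powR (l1^-1 + l2^-1) ((2 * M)%:R - (n%:R + 1) / 2))).

Definition f2 {R : realType} (l2 z : R) : R :=
  expR (- (z ^+ 2) / l2) / Num.sqrt (pi * l2).

Definition has_density {R : realType} d (T : measurableType d)
  (P : probability T R) (X : T -> R) (p : R -> R) : Prop :=
  forall A : set R, measurable A ->
    P (X @^-1` A) = (\int[@lebesgue_measure R]_(x in A) (p x)%:E)%E.

Definition indep3 {R : realType} d (T : measurableType d)
  (P : probability T R) (X Y Z : T -> R) : Prop :=
  forall A B C : set R, measurable A -> measurable B -> measurable C ->
    P (X @^-1` A `&` Y @^-1` B `&` Z @^-1` C)
    = (P (X @^-1` A) * P (Y @^-1` B) * P (Z @^-1` C))%E.

(* Main.v *)
(* Independence turns the law of (X, Re nu, Im nu) into a product, so by Tonelli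
   and translation invariance z_Re = s X + Re nu has density the convolution
   z |-> \int chi(x) N(z - s x) dx, and z_Re is independent of z_Im.
   Completing the square in chi(x) N(z - s x) and substituting v = k x - b, with
   k = sqrt(l1 / 2) sqrt(1 / l1 + 1 / l2) and b = z / (l2 sqrt(1 / l1 + 1 / l2)),
   reduces the convolution to \int_(-b)^oo (v + b)^(2M-1) e^(-v^2) dv.  The
   binomial formula leaves the truncated moments \int_(-b)^oo v^n e^(-v^2) dv,
   which t = v^2 turns into Gamma((n+1)/2) plus or minus gamma((n+1)/2, b^2); the
   sign depends on the sign of b and on the parity of n, whence c_n. *)
Require Import Defs.
From HB Require Import structures.
From mathcomp Require Import all_boot all_order all_algebra.
From mathcomp Require Import all_classical all_reals all_analysis.
From mathcomp Require Import measurable_realfun ring lra.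
Import Order.TTheory GRing.Theory Num.Theory.
Import numFieldNormedType.Exports HBNNSimple.
Local Open Scope classical_set_scope.
Local Open Scope ring_scope.

Set Implicit Arguments. Unset Strict Implicit. Unset Printing Implicit Defensive.

(** * Joint densities of independent variables *)

(** For the indicator of a measurable set the identity is the hypothesis on [m]. Linearity carries
    it to the simple functions [h n], and monotone convergence on both sides carries it to their
    increasing limit [f]. *)
Lemma integral_density d (T : measurableType d) (R : realType)
  (mu m : {measure set T -> \bar R}) (p : T -> R) (f : T -> \bar R) :
  measurable_fun setT p -> (forall x, 0 <= p x) ->
  (forall A, measurable A -> m A = (\int[mu]_(x in A) (p x)%:E)%E) ->
  measurable_fun setT f -> (forall x, (0 <= f x)%E) ->
  (\int[m]_x f x = \int[mu]_x (f x * (p x)%:E))%E.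
Proof.
move=> mp p0 mE mf f0; pose h := nnsfun_approx measurableT mf.
have mh n : measurable_fun setT (EFin \o h n).
  by apply/measurable_EFinP; exact/measurable_funP.
have hf x : EFin \o h ^~ x @ \oo --> f x by exact: cvg_nnsfun_approx.
have h_nd x : {homo (fun n => (h n x)%:E) : a b / (a <= b)%N >-> (a <= b)%E}.
  by move=> a b ab; rewrite lee_fin; exact/lefP/nd_nnsfun_approx.
transitivity (limn (fun n => \int[m]_x (h n x)%:E)%E).
  rewrite -monotone_convergence//.
  - by apply: eq_integral => x _; apply/esym/cvg_lim => //; exact: hf.
  - by move=> n x _; rewrite lee_fin; exact: fun_ge0.
transitivity (limn (fun n => \int[mu]_x ((h n x)%:E * (p x)%:E))%E); last first.
  rewrite -monotone_convergence//.
  - apply: eq_integral => x _; apply/cvg_lim => //.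
    by apply: cvgeZr => //; exact: hf.
  - by move=> n; apply: emeasurable_funM => //; exact/measurable_EFinP.
  - by move=> n x _; rewrite mule_ge0// lee_fin//; exact: fun_ge0.
  - by move=> x _ a b ab; rewrite lee_wpmul2r ?lee_fin//; have := h_nd x _ _ ab.
congr (limn _); apply/funext => n.
transitivity (\sum_(y \in range (h n)) (y%:E * m (h n @^-1` [set y])))%E.
  by rewrite integralT_nnsfun sintegralE.
transitivity (\sum_(y \in range (h n))
  \int[mu]_x ((y * \1_(h n @^-1` [set y]) x)%:E * (p x)%:E))%E; last first.
  rewrite -ge0_integral_fsum//; last 2 first.
  - move=> y; apply: emeasurable_funM; last exact/measurable_EFinP.
    by apply/measurable_EFinP; exact: measurable_funM.
  - by move=> y x _; rewrite mule_ge0 ?lee_fin//; exact: nnfun_muleindic_ge0.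
  apply: eq_integral => x _.
  rewrite -ge0_mule_fsuml; last by move=> y; exact: nnfun_muleindic_ge0.
  by rewrite fsumEFin // -(fimfunE _ x).
apply: eq_fsbigr => y /[!inE] -[x _ yx].
rewrite mE//.
under [RHS]eq_integral do rewrite EFinM -muleA.
rewrite ge0_integralZl//=; last 3 first.
- apply: emeasurable_funM; last exact/measurable_EFinP.
  by apply/measurable_EFinP.
- by move=> z _; rewrite mule_ge0 ?lee_fin.
- by rewrite -yx lee_fin; exact: fun_ge0.
congr (_ * _)%E.
rewrite integral_mkcond; apply: eq_integral => z _.
by rewrite epatch_indic muleC.
Qed.

(** Both sides are measures in [C] that agree on rectangles, and rectangles determine a product of
    finite measures. The additional event [D] is a slot for a third variable: it lets independence
    from that variable pass from [X] and [Y] to any measurable function of the pair. *)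
Lemma joint_measure_indep d d1 d2 (T : measurableType d) (T1 : measurableType d1)
  (T2 : measurableType d2) (R : realType) (P : probability T R)
  (X : {mfun T >-> T1}) (Y : {mfun T >-> T2}) (D : set T) :
  measurable D ->
  (forall (A : set T1) (B : set T2), measurable A -> measurable B ->
    P (X @^-1` A `&` Y @^-1` B `&` D) = (P (X @^-1` A) * P (Y @^-1` B) * P D)%E) ->
  forall C : set (T1 * T2), measurable C ->
    P ((fun w => (X w, Y w)) @^-1` C `&` D)
    = ((distribution P X \x distribution P Y) C * P D)%E.
Proof.
move=> mD PXYD C mC.
have mXY : measurable_fun setT (fun w => (X w, Y w)).
  by apply/measurable_fun_pair; exact: measurable_funP.
pose mXYf : {mfun T >-> _} :=
  HB.pack (fun w => (X w, Y w)) (isMeasurableFun.Build _ _ _ _ _ mXY).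
pose k : {nonneg R} := NngNum (fine_ge0 (measure_ge0 P D)).
have kE : k%:num%:E = P D by rewrite fineK// fin_num_measure.
(* The measure [P] restricted to [D], pushed forward by the pair. Its value on a rectangle carries
   the factor [P D], which is absorbed by scaling the first marginal by [k]. *)
pose m' : {measure set (T1 * T2) -> \bar R} := pushforward (mrestr P mD) mXYf.
rewrite -[LHS]/(m' mXY C) -(@product_measure_unique _ _ _ _ _
  (mscale k (distribution P X)) (distribution P Y) (m' mXY))//.
  rewrite /product_measure1/= ge0_integral_mscale//=; last first.
    exact: measurable_fun_xsection.
  by rewrite kE muleC.
move=> A B mA mB; rewrite /m'/= /mscale/= /pushforward /mrestr kE.
by rewrite [LHS]PXYD// /distribution /pushforward muleC muleA.
Qed.

Lemma joint_density_indep d d1 d2 (T : measurableType d) (T1 : measurableType d1)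
  (T2 : measurableType d2) (R : realType) (P : probability T R)
  (X : {mfun T >-> T1}) (Y : {mfun T >-> T2}) 
  (m1 : {sigma_finite_measure set T1 -> \bar R})
  (m2 : {sigma_finite_measure set T2 -> \bar R}) (p : T1 -> R) (r : T2 -> R) :
  measurable_fun setT p -> (forall x, 0 <= p x) ->
  measurable_fun setT r -> (forall x, 0 <= r x) ->
  (forall A, measurable A -> P (X @^-1` A) = \int[m1]_(x in A) (p x)%:E)%E ->
  (forall A, measurable A -> P (Y @^-1` A) = \int[m2]_(x in A) (r x)%:E)%E ->
  (forall (A : set T1) (B : set T2), measurable A -> measurable B ->
    P (X @^-1` A `&` Y @^-1` B) = (P (X @^-1` A) * P (Y @^-1` B))%E) ->
  forall C : set (T1 * T2), measurable C ->
    P ((fun w => (X w, Y w)) @^-1` C)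
    = (\int[m1 \x m2]_(z in C)
         (p z.1 * r z.2)%:E)%E.
Proof.
move=> mp p0 mr r0 Xp Yr XY C mC.
rewrite -[_ @^-1` C]setIT joint_measure_indep//; last first.
  by move=> A B mA mB; rewrite setIT XY// probability_setT mule1.
rewrite probability_setT mule1.
rewrite -[LHS]/(\int[distribution P X]_x (distribution P Y \o xsection C) x)%E.
have -> := @integral_density _ _ R m1 (distribution P X) p
  (distribution P Y \o xsection C)%E mp p0 Xp _ _; last 2 first.
- exact: measurable_fun_xsection.
- by move=> x; exact: measure_ge0.
have mpr : measurable_fun setT (fun z : T1 * T2 => (p z.1 * r z.2)%:E).
  apply/measurable_EFinP; apply: measurable_funM.
    exact: measurableT_comp.
  exact: measurableT_comp.
rewrite [RHS]integral_mkcond fubini_tonelli1/=; last 2 first.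
- by apply/(measurable_restrictT _ _).1 => //; exact: measurable_funTS.
- by move=> z; apply: erestrict_ge0 => *; rewrite lee_fin mulr_ge0.
apply: eq_integral => x _.
rewrite /distribution /pushforward Yr; last exact: measurable_xsection.
rewrite /fubini_F muleC -ge0_integralZl//=; last 4 first.
- exact: measurable_xsection.
- by apply/measurable_EFinP; exact: measurable_funTS.
- by move=> y _; rewrite lee_fin.
- by rewrite lee_fin.
rewrite integral_mkcond; apply: eq_integral => y _.
by rewrite !patchE mem_xsection EFinM.
Qed.

(** The preimage of []a, b]] under translation by [c] is []a - c, b - c]], of the same length. By
    uniqueness of Lebesgue measure, translation pushes it forward to itself. *)
Lemma ge0_integral_shift (R : realType) (c : R) (f : R -> \bar R) :
  measurable_fun setT f -> (forall x, (0 <= f x)%E) ->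
  (\int[@lebesgue_measure R]_x f x = \int[@lebesgue_measure R]_x f (x + c)%R)%E.
Proof.
move=> mf f0.
pose phi : measurableTypeR R -> measurableTypeR R := fun x : R => x + c.
have mphi : measurable_fun setT phi by exact: measurable_funD.
rewrite -[RHS](@ge0_integral_pushforward _ _ (measurableTypeR R)
  (measurableTypeR R) R phi mphi lebesgue_measure setT f)//.
apply: eq_measure_integral => A mA _.
apply: (@lebesgue_measure_unique _ (pushforward lebesgue_measure phi)) => //=.
move=> _ [[a b]] _ <-.
rewrite /pushforward.
have -> : phi @^-1` `]a, b] = `]a - c, b - c]%classic.
  by apply/seteqP; split => x /=; rewrite !in_itv/= ltrBlDr lerBrDr.
rewrite !lebesgue_measure_itv/= !lte_fin ltrD2r; case: ifPn => // _.
by congr EFin; ring.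
Qed.

Lemma density_affine_sum d (T : measurableType d) (R : realType)
  (P : probability T R) (X Y : {mfun T >-> measurableTypeR R}) (p r : R -> R) (a : R) :
  measurable_fun setT p -> (forall x, 0 <= p x) ->
  measurable_fun setT r -> (forall x, 0 <= r x) ->
  has_density P X p -> has_density P Y r ->
  (forall A B : set R, measurable A -> measurable B ->
    P (X @^-1` A `&` Y @^-1` B) = (P (X @^-1` A) * P (Y @^-1` B))%E) ->
  forall A : set R, measurable A ->
    P ((fun w => a * X w + Y w) @^-1` A)
    = (\int[@lebesgue_measure R]_(z in A)
         \int[@lebesgue_measure R]_x (p x * r (z - a * x))%:E)%E.
Proof.
move=> mp p0 mr r0 Xp Yr XY A mA.
pose s (z : R * R) := a * z.1 + z.2.
have ms : measurable_fun setT s.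
  by apply: measurable_funD => //; exact: measurable_funM.
have mC : measurable (s @^-1` A) by rewrite -[_ @^-1` _]setTI; exact: ms.
rewrite -[LHS]/(P ((fun w => (X w, Y w)) @^-1` (s @^-1` A))).
rewrite (@joint_density_indep _ _ _ _ _ _ _ _ _ _
  lebesgue_measure lebesgue_measure p r)//.
have mpr : measurable_fun setT (fun z : R * R => (p z.1 * r z.2)%:E).
  apply/measurable_EFinP; apply: measurable_funM.
    exact: measurableT_comp.
  exact: measurableT_comp.
rewrite integral_mkcond fubini_tonelli1/=; last 2 first.
- by apply/(measurable_restrictT _ _).1 => //; exact: measurable_funTS.
- by move=> z; apply: erestrict_ge0 => *; rewrite lee_fin mulr_ge0.
(* The joint density after the change of variable from [y] to [z = a * x + y] at fixed [x], cut off
   to [A]. Shifting the inner integral produces [g], and Tonelli then exchanges the order of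
   integration. *)
pose g (z : R * R) := if z.2 \in A then (p z.1 * r (z.2 - a * z.1))%:E else 0%E.
have mg : measurable_fun setT g.
  rewrite (_ : g = (fun z => (p z.1 * r (z.2 - a * z.1))%:E) \_ (setT `*` A));
    last first.
    by apply/funext => z; rewrite patchE /g in_setX in_setT.
  apply/(measurable_restrictT _ _).1; first exact: measurableX.
  apply: measurable_funTS; apply/measurable_EFinP; apply: measurable_funM.
    exact: measurableT_comp.
  apply: measurableT_comp => //; apply: measurable_funB => //.
  exact: measurable_funM.
have g0 z : (0 <= g z)%E.
  by rewrite /g; case: ifP => // _; rewrite lee_fin mulr_ge0.
transitivity (\int[@lebesgue_measure R]_x \int[@lebesgue_measure R]_y g (x, y))%E.
  apply: eq_integral => x _; rewrite /fubini_F (ge0_integral_shift (a * x)).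
  - apply: eq_integral => y _; rewrite patchE /g/= /s.
    have -> : ((x, y) \in (fun z : R * R => a * z.1 + z.2) @^-1` A)
        = (y + a * x \in A).
      by rewrite addrC; apply/idP/idP; rewrite !inE.
    by rewrite addrK; case: ifP.
  - exact: measurableT_comp.
  - by move=> y; exact: g0.
rewrite fubini_tonelli//= [RHS]integral_mkcond; apply: eq_integral => z _.
rewrite patchE /g /=; case: ifPn => // _.
exact: integral0.
Qed.

(** The first component has density [f] by [density_affine_sum], and [joint_density_indep] gives the
    product form once [a * X + Y] is known to be independent of [Z]. *)
Lemma joint_density_affine_sum d (T : measurableType d) (R : realType)
  (P : probability T R) (X Y Z : T -> R) (p r t f : R -> R) (a : R) :
  measurable_fun setT X -> measurable_fun setT Y -> measurable_fun setT Z ->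
  measurable_fun setT p -> (forall x, 0 <= p x) ->
  measurable_fun setT r -> (forall x, 0 <= r x) ->
  measurable_fun setT t -> (forall x, 0 <= t x) ->
  has_density P X p -> has_density P Y r -> has_density P Z t ->
  indep3 P X Y Z ->
  (forall z, (f z)%:E = \int[@lebesgue_measure R]_x (p x * r (z - a * x))%:E)%E ->
  forall A : set (R * R), measurable A ->
    P ((fun w => (a * X w + Y w, Z w)) @^-1` A)
    = (\int[(@lebesgue_measure R \x @lebesgue_measure R)%E]_(z in A)
         (f z.1 * t z.2)%:E)%E.
Proof.
move=> mX mY mZ mp p0 mr r0 mt t0 Xp Yr Zt XYZ fE A mA.
pose RR := measurableTypeR R.
pose Xf : {mfun T >-> RR} := HB.pack X (isMeasurableFun.Build _ _ T RR X mX).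
pose Yf : {mfun T >-> RR} := HB.pack Y (isMeasurableFun.Build _ _ T RR Y mY).
pose Zf : {mfun T >-> RR} := HB.pack Z (isMeasurableFun.Build _ _ T RR Z mZ).
have f0 z : 0 <= f z.
  by rewrite -lee_fin fE; apply: integral_ge0 => x _; rewrite lee_fin mulr_ge0.
have mf : measurable_fun setT f.
  apply/measurable_EFinP.
  rewrite (_ : _ \o _ = fun z =>
    \int[@lebesgue_measure R]_x (p x * r (z - a * x))%:E)%E; last first.
    by apply/funext => z; exact: fE.
  apply: (measurable_fun_fubini_tonelli_G
    (fun z : RR * RR => (p z.1 * r (z.2 - a * z.1))%:E)); last first.
    by move=> z /=; rewrite lee_fin mulr_ge0.
  apply/measurable_EFinP; apply: measurable_funM.
    exact: measurableT_comp.
  apply: measurableT_comp => //; apply: measurable_funB => //.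
  exact: measurable_funM.
have PT : P setT = 1%E by exact: probability_setT.
have XY B C : measurable B -> measurable C ->
    P (X @^-1` B `&` Y @^-1` C) = (P (X @^-1` B) * P (Y @^-1` C))%E.
  by move=> mB mC; have := XYZ B C setT mB mC measurableT;
    rewrite preimage_setT setIT PT mule1.
have mW : measurable_fun setT (fun w => a * X w + Y w).
  by apply: measurable_funD => //; exact: measurable_funM.
pose Wf : {mfun T >-> RR} := HB.pack (fun w => a * X w + Y w)
  (isMeasurableFun.Build _ _ T RR (fun w => a * X w + Y w) mW).
have Wd : has_density P Wf f.
  move=> B mB; rewrite [LHS](@density_affine_sum _ _ _ _ Xf Yf p r a)//.
  by apply: eq_integral => z _; rewrite -fE.
apply: (@joint_density_indep _ _ _ T RR RR R P Wf Zf
  lebesgue_measure lebesgue_measure f t) => //.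
move=> B C mB mC.
have mZC : measurable (Z @^-1` C) by rewrite -[_ @^-1` _]setTI; exact: (mZ).
pose D := (fun z : R * R => a * z.1 + z.2) @^-1` B.
have mD : measurable D.
  rewrite -[D]setTI.
  suff ms : measurable_fun setT (fun z : R * R => a * z.1 + z.2) by exact: ms.
  by apply: measurable_funD => //; exact: measurable_funM.
have XYC B1 B2 : measurable B1 -> measurable B2 ->
    P (X @^-1` B1 `&` Y @^-1` B2 `&` Z @^-1` C)
    = (P (X @^-1` B1) * P (Y @^-1` B2) * P (Z @^-1` C))%E.
  by move=> mB1 mB2; exact: XYZ.
have XYT B1 B2 : measurable B1 -> measurable B2 ->
    P (X @^-1` B1 `&` Y @^-1` B2 `&` setT)
    = (P (X @^-1` B1) * P (Y @^-1` B2) * P setT)%E.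
  by move=> mB1 mB2; rewrite setIT PT mule1 XY.
have jointC := @joint_measure_indep _ _ _ T RR RR R P Xf Yf _ mZC XYC D mD.
have jointT := @joint_measure_indep _ _ _ T RR RR R P Xf Yf
  setT measurableT XYT D mD.
rewrite [LHS]jointC; congr (_ * _)%E.
by rewrite -[LHS]mule1 -PT -[LHS]jointT setIT.
Qed.

(** * Gamma functions as Gaussian moments *)

(* The integrand of Gamma(1/2) is unbounded at 0: continuity is only assumed on
   ]0, +oo[, and the endpoint 0 is reached by monotone convergence. *)
Lemma integral_substitution_sqr_itv (R : realType) (G : R -> R) (a b : R) :
  0 < a -> a <= b -> {in `]0, +oo[, continuous G} ->
  (\int[@lebesgue_measure R]_(t in `[(a ^+ 2)%R, (b ^+ 2)%R]) (G t)%:E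
   = \int[@lebesgue_measure R]_(v in `[a, b]) (G (v ^+ 2) * (2 * v))%:E)%E.
Proof.
move=> a0 ab cG; pose F (v : R) := v ^+ 2.
have F'E : F^`()%classic = fun v => 2 * v.
  by apply/funext => v; rewrite exp_derive1 expr1.
have cF : continuous F by exact: exprn_continuous.
have cF' : continuous (fun v : R => 2 * v) by exact: mulrl_continuous.
have := @integration_by_substitution_increasing R F G a b ab; rewrite F'E; apply.
- move=> x y /[!in_itv]/= /andP[ax _] /andP[ay _] xy.
  by rewrite /F ltrXn2r// ?nnegrE (ltW (lt_le_trans a0 _)).
- by move=> x _; exact: cF'.
- by apply/cvg_ex; exists (2 * a); apply: cvg_at_right_filter; exact: cF'.
- by apply/cvg_ex; exists (2 * b); apply: cvg_at_left_filter; exact: cF'.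
- split=> [x _||].
  + exact: exprn_derivable.
  + by apply: cvg_at_right_filter; exact: cF.
  + by apply: cvg_at_left_filter; exact: cF.
- apply: continuous_in_subspaceT => x /[!inE]/= /[!in_itv]/= /andP[ax _].
  by apply: cG; rewrite in_itv/= andbT (lt_le_trans _ ax)// exprn_gt0.
Qed.

(** As [l k] decreases to 0 through positive values, the intervals [[l k, b]] increase to []0, b]],
    and monotone convergence applies to the nonnegative [f]. *)
Lemma integral_itv_bigcup (R : realType) (f : R -> R) (l : nat -> R) (b : R) :
  (forall k, 0 < l k) -> {homo l : m n / (m <= n)%N >-> n <= m} ->
  l @ \oo --> 0 ->
  {in `]0, +oo[, continuous f} -> (forall x : R, 0 < x -> 0 <= f x) ->
  (\int[@lebesgue_measure R]_(t in `[l k, b]) (f t)%:E @[k --> \oo] -->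
  \int[@lebesgue_measure R]_(t in `]0%R, b]) (f t)%:E)%E.
Proof.
move=> l0 l_nincr lcvg cf f0.
have mf : measurable_fun (`]0%R, +oo[ : set R) f.
  apply: open_continuous_measurable_fun => // x /[!inE] x0.
  exact: cf.
have -> : `]0, b]%classic = \bigcup_k `[l k, b]%classic.
  apply/seteqP; split => [x /=|x [k _] /=].
    rewrite in_itv/= => /andP[x0 xb].
    have [k _ /(_ _ (leqnn _)) lk] : \forall k \near \oo, l k < x.
      exact: (cvgr_lt _ lcvg).
    by exists k => //=; rewrite in_itv/= xb ltW.
  by rewrite !in_itv/= => /andP[lx ->]; rewrite andbT (lt_le_trans (l0 k)).
have sub k : `[l k, b]%classic `<=` `]0, +oo[%classic.
  by move=> x /=; rewrite !in_itv/= andbT => /andP[lx _]; exact: lt_le_trans lx.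
apply: ge0_nondecreasing_set_cvg_integral => //.
- move=> m n mn; apply/subsetPset => x /=; rewrite !in_itv/= => /andP[lx ->].
  by rewrite andbT (le_trans _ lx)// l_nincr.
- by move=> k; apply/measurable_EFinP; exact: measurable_funS mf.
- move=> k x /sub/=; rewrite in_itv/= andbT => x0.
  by rewrite lee_fin f0.
Qed.

Lemma continuous_substitution_sqr (R : realType) (G : R -> R) :
  {in `]0, +oo[, continuous G} ->
  {in `]0, +oo[, continuous (fun v : R => G (v ^+ 2) * (2 * v))}.
Proof.
move=> cG x; rewrite in_itv/= andbT => x0.
have cGsqr : {for x, continuous (G \o (fun v : R => v ^+ 2))}.
  apply: continuous_comp; first exact: exprn_continuous.
  by apply: cG; rewrite in_itv/= andbT exprn_gt0.
exact: continuousM cGsqr (@mulrl_continuous R 2 x).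
Qed.

Lemma integral_substitution_sqr_oc (R : realType) (G : R -> R) (b : R) :
  0 <= b -> {in `]0, +oo[, continuous G} -> (forall t, 0 < t -> 0 <= G t) ->
  (\int[@lebesgue_measure R]_(t in `]0%R, (b ^+ 2)%R]) (G t)%:E
   = \int[@lebesgue_measure R]_(v in `]0%R, b]) (G (v ^+ 2) * (2 * v))%:E)%E.
Proof.
rewrite le_eqVlt => /predU1P[<- _ _|b0 cG G0].
  by rewrite expr0n/= !set_itv_ge ?bnd_simp// ?ltxx// !integral_set0.
(* The sequence [b / (k + 1)] stays in []0, b]]. Both it and its square decrease to 0, so the
   intervals in [v] and in [t = v ^+ 2] exhaust their domains in step. *)
pose l k : R := b * k.+1%:R^-1.
have l0 k : 0 < l k by rewrite mulr_gt0// invr_gt0.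
have l_nincr : {homo l : m n / (m <= n)%N >-> n <= m}.
  by move=> m n mn; rewrite ler_pM2l// lef_pV2 ?posrE// ler_nat ltnS.
have lb k : l k <= b by rewrite ler_piMr ?(ltW b0)// invf_le1// ler1n.
have lcvg : l @ \oo --> 0.
  rewrite -(mulr0 b); apply: cvgM; first exact: cvg_cst.
  exact: cvg_harmonic.
have l2cvg : (fun k => l k ^+ 2) @ \oo --> 0.
  under eq_fun do rewrite expr2.
  by have := cvgM lcvg lcvg; rewrite mulr0; apply.
have H1 : (\int[@lebesgue_measure R]_(t in `[(l k ^+ 2)%R, (b ^+ 2)%R]) (G t)%:E
    @[k --> \oo] --> \int[@lebesgue_measure R]_(t in `]0%R, (b ^+ 2)%R]) (G t)%:E)%E.
  apply: (@integral_itv_bigcup R G (fun k => l k ^+ 2)) => // [k|m n mn].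
    by rewrite exprn_gt0.
  by rewrite lerXn2r ?nnegrE ?(ltW (l0 _))// l_nincr.
have H2 := @integral_itv_bigcup R (fun v => G (v ^+ 2) * (2 * v)) l b l0 l_nincr lcvg.
rewrite -(cvg_lim _ H1)// -(cvg_lim _ (H2 _ _))//.
- by apply: congr_lim; apply/funext => k; exact: integral_substitution_sqr_itv.
- exact: continuous_substitution_sqr.
- by move=> x x0; rewrite mulr_ge0 ?G0 ?exprn_gt0 ?mulr_ge0 ?ltW.
Qed.

Lemma integral_substitution_sqr_oy (R : realType) (G : R -> R) :
  {in `]0, +oo[, continuous G} -> (forall t, 0 < t -> 0 <= G t) ->
  (\int[@lebesgue_measure R]_(t in `]0%R, +oo[) (G t)%:E
   = \int[@lebesgue_measure R]_(v in `]0%R, +oo[) (G (v ^+ 2) * (2 * v))%:E)%E.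
Proof.
move=> cG G0.
have cG2 := continuous_substitution_sqr cG.
have lim (f : R -> R) (u : nat -> R) : {in `]0, +oo[, continuous f} ->
    (forall x : R, 0 < x -> 0 <= f x) ->
    {homo u : m n / (m <= n)%N >-> m <= n} -> (forall k, k%:R <= u k) ->
    (\int[@lebesgue_measure R]_(t in `]0%R, u k]) (f t)%:E @[k --> \oo] -->
     \int[@lebesgue_measure R]_(t in `]0%R, +oo[) (f t)%:E)%E.
  move=> cf f0 u_ndecr ku.
  have mf : measurable_fun (`]0%R, +oo[ : set R) f.
    by apply: open_continuous_measurable_fun => // x /[!inE] x0; exact: cf.
  have -> : `]0, +oo[%classic = \bigcup_k `]0, u k]%classic.
    apply/seteqP; split => [x /=|x [k _] /=].
      rewrite in_itv/= andbT => x0; exists (Num.truncn x).+1 => //=.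
      rewrite in_itv/= x0/= (le_trans _ (ku _))// ltW//.
      exact: truncnS_gt.
    by rewrite !in_itv/= andbT => /andP[].
  have sub k : `]0, u k]%classic `<=` `]0, +oo[%classic.
    by move=> x /=; rewrite !in_itv/= andbT => /andP[].
  apply: ge0_nondecreasing_set_cvg_integral => //.
  - move=> m n mn; apply/subsetPset => x /=; rewrite !in_itv/= => /andP[-> xu].
    by rewrite (le_trans xu)// u_ndecr.
  - by move=> k; apply/measurable_EFinP; exact: measurable_funS mf.
  - move=> k x /sub/=; rewrite in_itv/= andbT => x0.
    by rewrite lee_fin f0.
(* The right ends [(k + 1) ^ 2] for [t] and [k + 1] for [v] correspond under [t = v ^+ 2], so the
   two limits agree term by term. *)
have H1 : (\int[@lebesgue_measure R]_(t in `]0%R, (k.+1%:R ^+ 2)%R]) (G t)%:E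
    @[k --> \oo] --> \int[@lebesgue_measure R]_(t in `]0%R, +oo[) (G t)%:E)%E.
  apply: (lim G (fun k => k.+1%:R ^+ 2)) => // [m n mn|k].
    by rewrite lerXn2r ?nnegrE// ler_nat ltnS.
  by rewrite -natrX ler_nat expnS expn1 (leq_trans (leqnSn k))// leq_pmulr.
have H2 := lim _ (fun k => k.+1%:R) cG2.
rewrite -(cvg_lim _ H1)// -(cvg_lim _ (H2 _ _ _))//.
- by apply: congr_lim; apply/funext => k; rewrite integral_substitution_sqr_oc.
- by move=> x x0; rewrite mulr_ge0 ?G0 ?exprn_gt0 ?mulr_ge0 ?ltW.
- by move=> m n mn; rewrite ler_nat ltnS.
- by move=> k; rewrite ler_nat.
Qed.

(** * Truncated moments of the Gaussian *)

Definition gauss_monom {R : realType} (n : nat) (v : R) : R :=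
  v ^+ n * gauss_fun v.

Lemma continuous_gauss_monom (R : realType) n : continuous (@gauss_monom R n).
Proof.
move=> x.
exact: continuousM (@exprn_continuous R n x) (@continuous_gauss_fun R x).
Qed.

Lemma measurable_gauss_monom (R : realType) n :
  measurable_fun setT (@gauss_monom R n).
Proof.
by apply: measurable_funM; [exact: measurable_funX|exact: measurable_gauss_fun].
Qed.

(* With [x = v^2 / 2], [x^m / m! <= e^x] bounds [v^(2m) e^(- v^2 / 2)]. *)
Lemma gauss_monom_le_normal (R : realType) n : exists2 K : R, 0 <= K &
  forall v, `|gauss_monom n v| <= K * normal_pdf 0 1 v.
Proof.
(* The bound is assembled from [|v|^n <= 1 + (v^2)^(n+1)], [v^2 = 2 x] and [x^(n+1) <= (n+1)! e^x];
   the constant 1 is absorbed by [1 <= e^x]. *)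
pose K0 : R := 1 + 2 ^+ n.+1 * n.+1`!%:R.
have K00 : 0 <= K0 by rewrite addr_ge0// mulr_ge0// exprn_ge0.
pose c : R := normal_peak 1.
have c0 : 0 < c by exact: normal_peak_gt0.
exists (K0 / c); first by rewrite mulr_ge0// invr_ge0 ltW.
move=> v; rewrite normal_pdfE// -/c mulrA divfK ?gt_eqF//.
rewrite /normal_fun subr0 expr1n /gauss_monom /gauss_fun normrM normrX.
rewrite (ger0_norm (expR_ge0 _)).
set x := v ^+ 2 / 2.
have x0 : 0 <= x by rewrite divr_ge0// sqr_ge0.
have -> : - v ^+ 2 / 2 = - x by rewrite /x; field.
(* One half of the exponent dominates the monomial, the other half is the shape of the standard
   normal density. *)
have -> : - v ^+ 2 = - x - x by rewrite /x; field.
rewrite expRD mulrA ler_wpM2r ?expR_ge0//.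
rewrite expRN ler_pdivrMr ?expR_gt0//.
have v2 : `|v| ^+ n <= 1 + (v ^+ 2) ^+ n.+1.
  have [v1|v1] := leP `|v| 1.
    by rewrite (le_trans (exprn_ile1 _ (normr_ge0 v) v1))// lerDl exprn_ge0// sqr_ge0.
  rewrite -(real_normK (num_real v)) -exprM (@le_trans _ _ (`|v| ^+ (2 * n.+1)))//.
    by rewrite ler_eXn2l// mul2n -addnn (leq_trans (leqnSn n))// leq_addr.
  by rewrite lerDr.
apply: (le_trans v2).
have vx : v ^+ 2 = 2 * x by rewrite /x; field.
have := expR_ge1Dxn n x0 => ex.
have ex1 : 1 <= expR x by rewrite -expR0 ler_expR.
have fact0 : 0 < n.+1`!%:R :> R by rewrite ltr0n fact_gt0.
have ex2 : x ^+ n.+1 <= n.+1`!%:R * expR x.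
  by rewrite mulrC -ler_pdivrMr// (le_trans _ ex)// lerDr.
rewrite vx exprMn /K0 mulrDl mul1r lerD// -mulrA ler_wpM2l// exprn_ge0//.
Qed.

Lemma integrable_gauss_monom (R : realType) n (D : set R) : measurable D ->
  (@lebesgue_measure R).-integrable D (EFin \o gauss_monom n).
Proof.
move=> mD; have [K K0 le_K] := gauss_monom_le_normal R n.
apply: (@integrableS _ _ _ _ setT) => //.
have iK : (@lebesgue_measure R).-integrable setT
    (fun v => K%:E * (normal_pdf 0 1 v)%:E)%E.
  by apply: integrableZl => //; exact: integrable_normal_pdf.
apply: le_integrable iK => //.
- by apply/measurable_EFinP; exact: measurable_gauss_monom.
- move=> v _ /=; rewrite lee_fin (le_trans (le_K v))//.
  by rewrite ler_norm.
Qed.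

Lemma powR_sqr_half (R : realType) n (v : R) : 0 < v ->
  powR (v ^+ 2) ((n%:R + 1) / 2 - 1) * expR (- v ^+ 2) * (2 * v)
  = 2 * gauss_monom n v.
Proof.
move=> v0; rewrite -powR_mulrn ?ltW// -powRrM.
rewrite (_ : 2 * _ = n%:R - 1); last by field.
(* For [n = 0] the exponent [n - 1] is negative, so it is split as a difference of real exponents,
   using that [v] is nonzero. *)
rewrite powRB ?(gt_eqF v0) ?implybT// powRr1 ?ltW// powR_mulrn ?ltW//.
by rewrite /gauss_monom /gauss_fun powR_mulrn ?ltW//; field; rewrite gt_eqF.
Qed.

Lemma continuous_gamma_integrand (R : realType) (s : R) :
  {in `]0, +oo[, continuous (fun t : R => powR t (s - 1) * expR (- t))}.
Proof.
move=> t; rewrite in_itv/= andbT => t0.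
have c1 : {for t, continuous (fun x : R => powR x (s - 1))}.
  apply/differentiable_continuous/derivable1_diffP.
  by apply: derivable_powR; rewrite ?in_itv/= ?andbT.
have c2 : {for t, continuous (fun x : R => expR (- x))}.
  by apply: continuous_comp; [exact: opp_continuous|exact: continuous_expR].
exact: continuousM c1 c2.
Qed.

Lemma Gamma_fn_half (R : realType) n : Gamma_fn ((n%:R + 1) / 2 : R)
  = 2 * \int[@lebesgue_measure R]_(v in `]0, +oo[) gauss_monom n v.
Proof.
rewrite -RintegralZl//; last exact: integrable_gauss_monom.
rewrite /Gamma_fn (_ : [set t : R | 0 < t] = `]0, +oo[%classic); last first.
  by apply/seteqP; split => t /=; rewrite in_itv/= andbT.
rewrite integral_substitution_sqr_oy; last 2 first.
- exact: continuous_gamma_integrand.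
- by move=> t _; rewrite mulr_ge0 ?powR_ge0 ?expR_ge0.
congr fine; apply: eq_integral => v /[!inE]/= /[!in_itv]/= /andP[v0 _].
by rewrite powR_sqr_half.
Qed.

Lemma lower_gamma_half (R : realType) n (b : R) : 0 <= b ->
  lower_gamma ((n%:R + 1) / 2 : R) (b ^+ 2)
  = 2 * \int[@lebesgue_measure R]_(v in `]0, b]) gauss_monom n v.
Proof.
move=> b0; rewrite -RintegralZl//; last exact: integrable_gauss_monom.
rewrite /lower_gamma.
rewrite (_ : [set t : R | 0 < t <= b ^+ 2] = `]0, (b ^+ 2)%R]%classic); last first.
  by apply/seteqP; split => t /=; rewrite in_itv.
rewrite integral_substitution_sqr_oc//; last 2 first.
- exact: continuous_gamma_integrand.
- by move=> t _; rewrite mulr_ge0 ?powR_ge0 ?expR_ge0.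
congr fine; apply: eq_integral => v /[!inE]/= /[!in_itv]/= /andP[v0 _].
by rewrite powR_sqr_half.
Qed.

(** Under [v -> - v] the Gaussian factor is even and the monomial contributes its parity; this is
    the source of [(-1) ^+ n] in [c_sign]. *)
Lemma Rintegral_gauss_monom_oppr (R : realType) n (b : R) : 0 <= b ->
  \int[@lebesgue_measure R]_(v in `[- b, 0]) gauss_monom n v
  = (-1) ^+ n * \int[@lebesgue_measure R]_(v in `]0, b]) gauss_monom n v.
Proof.
move=> b0; rewrite Rintegral_itv_obnd_cbnd; last exact: integrable_gauss_monom.
rewrite -RintegralZl//; last exact: integrable_gauss_monom.
rewrite /Rintegral -{1}oppr0.
rewrite integration_by_substitution_oppr//; last first.
  by apply: continuous_subspaceT; exact: continuous_gauss_monom.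
congr fine; apply: eq_integral => v _ /=.
by rewrite /gauss_monom /gauss_fun sqrrN [(- v) ^+ n]exprNn mulrA.
Qed.

(** If [b >= 0], the tail is the half-line []0, +oo[] plus the reflected piece [[- b, 0]], hence the
    sign [(-1) ^+ n]. If [b < 0], it is the half-line minus []0, - b]], hence the sign -1 whatever
    the parity. The hypothesis allows [c_sign] to test [z], of which [b] will be a positive
    multiple. *)
Lemma Rintegral_gauss_monom_tail (R : realType) n (b z : R) :
  (0 <= b) = (0 <= z) ->
  2 * \int[@lebesgue_measure R]_(v in `[- b, +oo[) gauss_monom n v
  = Gamma_fn ((n%:R + 1) / 2) + c_sign n z * lower_gamma ((n%:R + 1) / 2) (b ^+ 2).
Proof.
rewrite /c_sign => <-; have [b0|b0] := leP 0 b.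
  rewrite Gamma_fn_half lower_gamma_half// mulrCA -mulrDr; congr (_ * _).
  rewrite -Rintegral_gauss_monom_oppr// addrC.
  rewrite -Rintegral_setU//; last 2 first.
  - by apply: integrable_gauss_monom; exact: measurableU.
  - apply/disj_set2P/seteqP; split => // v [/=].
    by rewrite !in_itv/= andbT => /andP[_ v0]; rewrite ltNge v0.
  congr (Rintegral _ _ _).
  apply/seteqP; split => v /=; rewrite !in_itv/= !andbT.
    by move=> bv; case: (leP v 0) => v0; [left|right]; rewrite ?bv.
  by case=> [/andP[]//|v0]; rewrite (le_trans _ (ltW v0))// oppr_le0.
rewrite -sqrrN Gamma_fn_half lower_gamma_half ?oppr_ge0 ?ltW//.
have -> : `]0, +oo[%classic = `]0, (- b)]%classic `|` `](- b), +oo[%classic :> set R.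
  apply/seteqP; split => v /=; rewrite !in_itv/= !andbT.
    by move=> v0; rewrite v0/=; case: (leP v (- b)) => bv; [left|right].
  by case=> [/andP[]//|]; apply: lt_trans; rewrite oppr_gt0.
rewrite Rintegral_setU//; last 2 first.
- by apply: integrable_gauss_monom; exact: measurableU.
- apply/disj_set2P/seteqP; split => // v [/=].
  by rewrite !in_itv/= andbT => /andP[_ v0]; rewrite ltNge v0.
rewrite [X in _ = 2 * (_ + X) + _]Rintegral_itv_obnd_cbnd; last first.
  exact: integrable_gauss_monom.
by ring.
Qed.

(** * Convolution of the chi and normal densities *)

Lemma integral_shifted_gauss (R : realType) (m : nat) (b : R) :
  (\int[@lebesgue_measure R]_(v in `[(- b)%R, +oo[) ((v + b) ^+ m * gauss_fun v)%:E
   = (\sum_(n < m.+1) 'C(m, n)%:R * b ^+ (m - n)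
       * \int[@lebesgue_measure R]_(v in `[(- b)%R, +oo[) gauss_monom n v)%R%:E)%E.
Proof.
have igm n : (@lebesgue_measure R).-integrable `[- b, +oo[
    (EFin \o gauss_monom n) by exact: integrable_gauss_monom.
transitivity (\int[@lebesgue_measure R]_(v in `[(- b)%R, +oo[)
    (\sum_(n < m.+1) ('C(m, n)%:R * b ^+ (m - n))%:E * (gauss_monom n v)%:E))%E.
  apply: eq_integral => v _; rewrite addrC exprDn mulr_suml -sumEFin.
  apply: eq_bigr => n _; rewrite -EFinM; congr EFin.
  by rewrite /gauss_monom -mulr_natl !mulrA.
rewrite integral_sum//; last first.
  by move=> n; apply: integrableZl => //; exact: igm.
rewrite -sumEFin; apply: eq_bigr => n _.
rewrite integralZl//; last exact: igm.
rewrite [RHS]EFinM /Rintegral fineK//.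
by apply: integrable_fin_num => //; exact: igm.
Qed.

(** The substitution [v = k * x - b] is increasing and sends 0 to [- b]. On the range [v + b >= 0],
    so the integrand is nonnegative, as the substitution on a half-line requires. *)
Lemma integral_affine_gauss (R : realType) (m : nat) (k b : R) : 0 < k ->
  (\int[@lebesgue_measure R]_(v in `[(- b)%R, +oo[) ((v + b) ^+ m * gauss_fun v)%:E
   = \int[@lebesgue_measure R]_(x in `[0%R, +oo[)
       ((k * x) ^+ m * gauss_fun (k * x - b) * k)%:E)%E.
Proof.
move=> k0; pose F (x : R) := k * x - b.
pose G (v : R) := (v + b) ^+ m * gauss_fun v.
have F'E : F^`()%classic = cst k.
  apply/funext => x; rewrite derive1E deriveB// deriveM// derive_id.
  by rewrite !derive_cst scaler0 addr0 subr0 scaler1.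
have cF : continuous F.
  by move=> x; apply: continuousB; [exact: mulrl_continuous|exact: cst_continuous].
have cG : continuous G.
  move=> v.
  have c1 : {for v, continuous (fun v : R => (v + b) ^+ m)}.
    apply: (@continuous_comp _ _ _ (fun v : R => v + b) (fun v => v ^+ m)).
      by apply: continuousD => //; exact: cst_continuous.
    exact: exprn_continuous.
  exact: continuousM c1 (@continuous_gauss_fun R v).
have F0 : F 0 = - b by rewrite /F mulr0 sub0r.
have := @increasing_ge0_integration_by_substitutiony R F G 0.
rewrite F'E F0 => ->.
- by apply: eq_integral => x _; rewrite !fctE /G /F subrK.
- by move=> x y _ _ xy; rewrite /F ltrD2r ltr_pM2l.
- by move=> x _; exact: cst_continuous.
- exact: is_cvg_cst.
- exact: is_cvg_cst.
- split; last by apply: cvg_at_right_filter; exact: cF.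
  by move=> x _; apply: derivableB => //; exact: derivableM.
- have kx : (k * x : R) @[x --> +oo] --> +oo.
    under eq_fun do rewrite mulrC.
    by apply: gt0_cvgMly => //; exact: cvg_id.
  exact: cvg_comp kx (cvg_addrr (- b)).
- by apply: continuous_subspaceT; exact: cG.
- move=> v; rewrite in_itv/= andbT => bv.
  by rewrite mulr_ge0 ?gauss_fun_ge0// exprn_ge0// -lerBlDr sub0r ltW.
Qed.

(* Completing the square in the exponent, with [a = 1/l1 + 1/l2]. *)
Lemma chi_normal_kernel (R : realType) (M : nat) (l1 l2 z x : R) :
  0 < l1 -> 0 < l2 -> 0 <= x ->
  let k := Num.sqrt (l1 / 2) * Num.sqrt (l1^-1 + l2^-1) in
  let b := z / (l2 * Num.sqrt (l1^-1 + l2^-1)) in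
  chi_pdf (2 * M.+1) x * normal_pdf 0 (Num.sqrt (l2 / 2)) (z - Num.sqrt (l1 / 2) * x)
  = expR (- (z ^+ 2) / l2 * (1 - l1 / (l1 + l2)))
    / (2 ^+ M * Gamma_fn M.+1%:R * Num.sqrt (pi * l2) * k ^+ (2 * M.+1))
    * ((k * x) ^+ (2 * M.+1).-1 * gauss_fun (k * x - b) * k).
Proof.
move=> l10 l20 x0 k b.
set s := Num.sqrt (l1 / 2); set A := Num.sqrt (l1^-1 + l2^-1).
have l12 : 0 < l1 + l2 by rewrite addr_gt0.
have s2 : s ^+ 2 = l1 / 2 by rewrite sqr_sqrtr// divr_ge0// ltW.
have A2 : A ^+ 2 = l1^-1 + l2^-1 by rewrite sqr_sqrtr// addr_ge0// invr_ge0 ltW.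
have s0 : 0 < s by rewrite sqrtr_gt0 divr_gt0.
have A0 : 0 < A by rewrite sqrtr_gt0 addr_gt0// invr_gt0.
have k0 : k != 0 by rewrite mulf_neq0// gt_eqF.
have t0 : Num.sqrt (l2 / 2) != 0 by rewrite gt_eqF// sqrtr_gt0 divr_gt0.
have t2 : Num.sqrt (l2 / 2) ^+ 2 *+ 2 = l2.
  by rewrite sqr_sqrtr ?divr_ge0 ?ltW// -mulr_natr divfK.
have -> : normal_pdf 0 (Num.sqrt (l2 / 2)) (z - s * x)
    = (Num.sqrt (pi * l2))^-1 * expR (- (z - s * x) ^+ 2 / l2).
  rewrite normal_pdfE// /normal_peak /normal_fun subr0 t2; congr (_^-1 * _).
  by rewrite -mulrnAl t2 mulrC.
(* Coefficients are compared as polynomials in [x]: [k ^+ 2] matches the quadratic term, [k * b] the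
   cross term, and [b ^+ 2] is what completing the square takes out of [z ^+ 2 / l2]. *)
have expE : - x ^+ 2 / 2 + - (z - s * x) ^+ 2 / l2
    = - z ^+ 2 / l2 * (1 - l1 / (l1 + l2)) + - (k * x - b) ^+ 2.
  have k2 : k ^+ 2 = (l1 + l2) / (2 * l2).
    rewrite exprMn s2 A2; field.
    by rewrite !gt_eqF.
  have b2 : b ^+ 2 = z ^+ 2 / l2 * (l1 / (l1 + l2)).
    rewrite /b -/A expr_div_n exprMn A2; field.
    by rewrite !gt_eqF.
  have kb : k * b = s * z / l2.
    by rewrite /k /b -/s -/A; field; rewrite !gt_eqF.
  rewrite [(k * x - b) ^+ 2]sqrrB exprMn k2 b2.
  have -> : k * x * b = s * z / l2 * x by rewrite -kb; ring.
  rewrite sqrrB exprMn s2; field.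
  by rewrite !gt_eqF.
rewrite /chi_pdf x0.
(* Here [M.+1] stands for the number of antennas, so the chi normalisation has exponent
   [(2 * M.+1) / 2 - 1 = M]. *)
have -> : powR 2 ((2 * M.+1)%:R / 2 - 1) = 2 ^+ M :> R.
  rewrite (_ : _ - 1 = M%:R) ?powR_mulrn//.
  by rewrite natrM -natr1; field.
have -> : (2 * M.+1)%:R / 2 = M.+1%:R :> R by rewrite natrM; field.
have kx : (k * x) ^+ (2 * M.+1).-1 * k = x ^+ (2 * M.+1).-1 * k ^+ (2 * M.+1).
  by rewrite exprMn -[in RHS](@prednK (2 * M.+1)%N)// exprS; ring.
rewrite [X in _ = _ * X]mulrAC kx.
have kM0 : k ^+ (2 * M.+1) != 0 by rewrite expf_neq0.
transitivity (x ^+ (2 * M.+1).-1 / (2 ^+ M * Gamma_fn M.+1%:R * Num.sqrt (pi * l2))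
  * (expR (- x ^+ 2 / 2) * expR (- (z - s * x) ^+ 2 / l2))).
  by rewrite !invfM; ring.
rewrite -expRD expE expRD /gauss_fun !invfM.
rewrite -[LHS]mulr1 -[X in _ * X](mulfV kM0).
by ring.
Qed.

(** Put [A ^+ 2 = l1^-1 + l2^-1] and [j = 2 * M.+1 - 1 - n]. The real power is then
    [A ^+ (j + 2 * M.+1)]: [j] factors of [A] turn [z / l2] into [b], and the others join
    [l1 ^+ M.+1] to form [k ^+ (2 * M.+1)] up to a power of 2. *)
Lemma f1_term_coef (R : realType) (M n : nat) (l1 l2 z : R) :
  (n < 2 * M.+1)%N -> 0 < l1 -> 0 < l2 ->
  let k := Num.sqrt (l1 / 2) * Num.sqrt (l1^-1 + l2^-1) in
  let b := z / (l2 * Num.sqrt (l1^-1 + l2^-1)) in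
  (l1 ^+ M.+1)^-1 / ((z / l2) ^ ((n.+1)%:Z - (2 * M.+1)%:Z)
    * powR (l1^-1 + l2^-1) ((2 * M.+1)%:R - (n%:R + 1) / 2))
  = b ^+ ((2 * M.+1).-1 - n) / (2 ^+ M * k ^+ (2 * M.+1)) / 2.
Proof.
move=> nM l10 l20 k b; rewrite {}/k {}/b.
set A := Num.sqrt (l1^-1 + l2^-1).
have A0 : 0 < A by rewrite sqrtr_gt0 addr_gt0// invr_gt0.
have A2 : l1^-1 + l2^-1 = A ^+ 2 by rewrite sqr_sqrtr// addr_ge0// invr_ge0 ltW.
pose j := ((2 * M.+1).-1 - n)%N.
have jn : (2 * M.+1 = j + n + 1)%N.
  by rewrite addn1 /j subnK ?prednK// -ltnS prednK.
have jE : (2 * M.+1)%:R = j%:R + n%:R + 1 :> R by rewrite jn !natrD.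
have -> : powR (l1^-1 + l2^-1) ((2 * M.+1)%:R - (n%:R + 1) / 2) = A ^+ (j + 2 * M.+1).
  rewrite A2 -powR_mulrn ?ltW// -powRrM -powR_mulrn ?ltW//; congr powR.
  by rewrite natrD jE; field.
(* The exponent in the denominator is never positive, so inverting it gives the natural power
   [(z / l2) ^+ j]; with the convention that 0 is its own inverse this also covers [z = 0]. *)
have -> : (n.+1)%:Z - (2 * M.+1)%:Z = - j%:Z.
  by rewrite jn -addn1 !PoszD; ring.
rewrite invfM invr_expz opprK -exprnP -/j.
rewrite [(Num.sqrt (l1 / 2) * A) ^+ _]exprMn.
rewrite [Num.sqrt (l1 / 2) ^+ _]exprM sqr_sqrtr ?divr_ge0 ?ltW//.
rewrite exprD [in RHS]expr_div_n [(l2 * A) ^+ j]exprMn !expr_div_n [2 ^+ M.+1]exprS.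
have Aj : A ^+ j != 0 by rewrite expf_neq0 ?gt_eqF.
have AM : A ^+ (2 * M.+1) != 0 by rewrite expf_neq0 ?gt_eqF.
have l2j : l2 ^+ j != 0 by rewrite expf_neq0 ?gt_eqF.
have l1M : l1 ^+ M.+1 != 0 by rewrite expf_neq0 ?gt_eqF.
have twoM : 2 ^+ M != 0 :> R by rewrite expf_neq0.
move: (A ^+ j) (A ^+ (2 * M.+1)) (l2 ^+ j) (l1 ^+ M.+1) (2 ^+ M) Aj AM l2j l1M twoM.
move=> u1 u2 u3 u4 u5 *; field.
by do ?[apply/andP; split].
Qed.

Lemma f1_convolution (R : realType) (M : nat) (l1 l2 z : R) :
  0 < l1 -> 0 < l2 -> (0 < M)%N ->
  (f1 M l1 l2 z)%:E = (\int[@lebesgue_measure R]_x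
    (chi_pdf (2 * M) x
     * normal_pdf 0 (Num.sqrt (l2 / 2)) (z - Num.sqrt (l1 / 2) * x))%:E)%E.
Proof.
move=> l10 l20; case: M => // M _.
pose A := Num.sqrt (l1^-1 + l2^-1).
pose k := Num.sqrt (l1 / 2) * A; pose b := z / (l2 * A).
have l12 : 0 < l1 + l2 by rewrite addr_gt0.
have A0 : 0 < A by rewrite sqrtr_gt0 addr_gt0// invr_gt0.
have k0 : 0 < k by rewrite mulr_gt0// sqrtr_gt0 divr_gt0.
have b2 : z ^+ 2 / l2 * (l1 / (l1 + l2)) = b ^+ 2.
  rewrite /b /A expr_div_n exprMn sqr_sqrtr ?addr_ge0 ?invr_ge0 ?ltW//; field.
  by rewrite !gt_eqF ?addr_gt0.
have bz : (0 <= b) = (0 <= z) by rewrite pmulr_lge0// invr_gt0 mulr_gt0.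
(* The factors of the kernel that do not depend on [x]. *)
pose K := expR (- (z ^+ 2) / l2 * (1 - l1 / (l1 + l2)))
    / (2 ^+ M * Gamma_fn M.+1%:R * Num.sqrt (pi * l2) * k ^+ (2 * M.+1)).
pose h x := (k * x) ^+ (2 * M.+1).-1 * gauss_fun (k * x - b) * k.
have mh : measurable_fun setT h.
  apply: measurable_funM => //; apply: measurable_funM.
    by apply: measurable_funX; exact: measurable_funM.
  apply: measurableT_comp; first exact: measurable_gauss_fun.
  by apply: measurable_funB => //; exact: measurable_funM.
have h0 x : 0 <= x -> 0 <= h x.
  move=> x0; rewrite mulr_ge0 ?(ltW k0)// mulr_ge0 ?gauss_fun_ge0//.
  by rewrite exprn_ge0// mulr_ge0// ltW.
transitivity (K%:E * \int[@lebesgue_measure R]_(x in `[0%R, +oo[) (h x)%:E)%E.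
  rewrite -integral_affine_gauss// integral_shifted_gauss -EFinM; congr EFin.
  rewrite prednK// /f1 mulr_sumr [RHS]mulr_sumr; apply: eq_bigr => n _.
  (* The bracket of Gamma functions becomes twice the truncated moment [I], and this 2 cancels the
     final [/ 2] of [f1_term_coef]. *)
  rewrite b2 -Rintegral_gauss_monom_tail//.
  set I := \int[_]_(_ in _) _.
  have := @f1_term_coef R M n l1 l2 z (ltn_ord n) l10 l20; rewrite /= -/A -/k -/b.
  rewrite /K; set W := (_ ^ _ * powR _ _) => W_E.
  transitivity (expR (- z ^+ 2 / l2 * (1 - l1 / (l1 + l2))) / Gamma_fn M.+1%:R
    / Num.sqrt (pi * l2) * 'C((2 * M.+1).-1, n)%:R * (2 * I)
    * ((l1 ^+ M.+1)^-1 / W)).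
    by rewrite !invfM; ring.
  rewrite W_E !invfM.
  have two0 : 2 != 0 :> R by [].
  by rewrite -[in RHS](mulKf two0 I); ring.
have K_h x : 0 <= x -> chi_pdf (2 * M.+1) x
    * normal_pdf 0 (Num.sqrt (l2 / 2)) (z - Num.sqrt (l1 / 2) * x) = K * h x.
  by move=> x0; rewrite chi_normal_kernel.
have Gamma_ge0 : 0 <= Gamma_fn (M.+1%:R : R).
  apply: fine_ge0; apply: integral_ge0 => t _.
  by rewrite lee_fin mulr_ge0 ?powR_ge0 ?expR_ge0.
have K0 : 0 <= K.
  rewrite divr_ge0 ?expR_ge0// mulr_ge0 ?exprn_ge0 ?(ltW k0)//.
  by rewrite mulr_ge0 ?sqrtr_ge0// mulr_ge0 ?exprn_ge0.
rewrite -ge0_integralZl//; last 2 first.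
- by apply/measurable_EFinP; exact: measurable_funTS.
- by move=> x /=; rewrite in_itv/= andbT lee_fin => /h0.
rewrite integral_mkcond; apply: eq_integral => x _.
rewrite patchE; case: ifPn.
  by rewrite inE/= in_itv/= andbT => x0; rewrite K_h.
rewrite notin_setE/= in_itv/= andbT => /negP /negbTE x0.
by rewrite /chi_pdf x0 mul0r.
Qed.

(** * Regularity of the densities, positivity of the parameters, and the joint law *)

Lemma measurable_chi_pdf (R : realType) (n : nat) :
  measurable_fun setT (@chi_pdf R n).
Proof.
rewrite /chi_pdf; apply: measurable_fun_ifT => //=.
  exact: measurable_fun_ler.
apply: measurable_funM => //; apply: measurable_funM.
  exact: measurable_funX.
apply: measurableT_comp => //; apply: measurable_funM => //.
by apply: measurableT_comp => //; exact: measurable_funX.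
Qed.

Lemma chi_pdf_ge0 (R : realType) (n : nat) (x : R) : 0 <= chi_pdf n x.
Proof.
rewrite /chi_pdf; case: ifPn => // x0.
rewrite divr_ge0// mulr_ge0 ?exprn_ge0 ?expR_ge0 ?powR_ge0//.
apply: fine_ge0; apply: integral_ge0 => t _.
by rewrite lee_fin mulr_ge0 ?powR_ge0 ?expR_ge0.
Qed.

(** A real component of a circular complex normal variable of variance [l2] has variance [l2 / 2],
    and twice this is [l2], in the exponent as under the square root. *)
Lemma f2_normal_pdf (R : realType) (l2 z : R) : 0 < l2 ->
  f2 l2 z = normal_pdf 0 (Num.sqrt (l2 / 2)) z.
Proof.
move=> l20.
have t2 : Num.sqrt (l2 / 2) ^+ 2 *+ 2 = l2.
  by rewrite sqr_sqrtr ?divr_ge0 ?ltW// -mulr_natr divfK.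
rewrite normal_pdfE ?gt_eqF ?sqrtr_gt0 ?divr_gt0//.
rewrite /f2 /normal_peak /normal_fun subr0 t2 mulrC; congr (_^-1 * _).
by rewrite -mulrnAl t2 mulrC.
Qed.

Lemma lambda1_gt0 (R : realType) (rho q beta : R) (tau : nat) (sigma2 alpha : R) :
  0 < rho -> 0 < q -> 0 < beta -> (0 < tau)%N -> 0 < alpha + sigma2 ->
  0 < lambda1 rho q beta tau sigma2 alpha.
Proof.
move=> rho0 q0 beta0 tau0 as0.
by rewrite divr_gt0// mulr_gt0 ?exprn_gt0 ?ltr0n// mulr_gt0 ?exprn_gt0// mulr_gt0.
Qed.

(** Writing [lambda1] as [q * beta * tau] times [rho * beta * tau / (alpha + sigma2)], the
    constraint on [alpha] makes the last ratio at most 1. The noise power [sigma2] then remains as a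
    positive excess. *)
Lemma lambda2_gt0 (R : realType) (rho q beta : R) (tau : nat)
    (sigma2 Ups alpha : R) :
  0 < rho -> 0 < q -> 0 < beta -> (0 < tau)%N -> 0 < sigma2 -> 0 <= Ups ->
  rho * beta * tau%:R <= alpha ->
  0 < lambda2 rho q beta tau sigma2 Ups alpha.
Proof.
move=> rho0 q0 beta0 tau0 sigma0 Ups0 le_alpha.
have t0 : 0 < tau%:R :> R by rewrite ltr0n.
have as0 : 0 < alpha + sigma2.
  by rewrite ltr_wpDl// (le_trans _ le_alpha)// !mulr_ge0 ?ltW.
have : lambda1 rho q beta tau sigma2 alpha <= q * beta * tau%:R.
  rewrite ler_pdivrMr//.
  have -> : rho * q * beta ^+ 2 * tau%:R ^+ 2
      = q * beta * tau%:R * (rho * beta * tau%:R) by ring.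
  by rewrite ler_pM2l ?mulr_gt0// (le_trans le_alpha)// lerDl ltW.
rewrite /lambda2; lra.
Qed.

(* x ~ chi_{2M}; Re nu, Im nu ~ N(0, lambda_2/2) (nu ~ CN(0, lambda_2)); all independent.
   g = sqrt(lambda_1/2) x,  z_Re = g + Re nu,  z_Im = Im nu.
   Conclusion: (z_Re, z_Im) has joint density f1(z_Re|alpha) * f2(z_Im|alpha),
   i.e. the likelihood maximised in the ML estimate is f1 * f2. *)
Theorem theorem1 (R : realType) (d : measure_display) (T : measurableType d)
  (P : probability T R) (M tau : nat) (rho beta q sigma2 Ups alpha : R)
  (X NRe NIm : T -> R) :
  (0 < M)%N -> (0 < tau)%N ->
  0 < rho -> 0 < beta -> 0 < q -> 0 < sigma2 -> 0 <= Ups ->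
  rho * beta * tau%:R <= alpha ->
  measurable_fun setT X -> measurable_fun setT NRe -> measurable_fun setT NIm ->
  let l1 := lambda1 rho q beta tau sigma2 alpha in
  let l2 := lambda2 rho q beta tau sigma2 Ups alpha in
  has_density P X (chi_pdf (2 * M)) ->
  has_density P NRe (normal_pdf 0 (Num.sqrt (l2 / 2))) ->
  has_density P NIm (normal_pdf 0 (Num.sqrt (l2 / 2))) ->
  indep3 P X NRe NIm ->
  forall A : set (R * R), measurable A ->
    P ((fun w => (Num.sqrt (l1 / 2) * X w + NRe w, NIm w)) @^-1` A)
    = (\int[(@lebesgue_measure R \x @lebesgue_measure R)%E]_(p in A)
         (f1 M l1 l2 p.1 * f2 l2 p.2)%:E)%E.
Proof.
move=> M0 tau0 rho0 beta0 q0 sigma0 Ups0 le_alpha mX mNRe mNIm l1 l2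
  Xchi NRen NImn indep.
have l10 : 0 < l1.
  apply: lambda1_gt0 => //.
  by rewrite ltr_wpDl// (le_trans _ le_alpha)// !mulr_ge0 ?ltW ?ltr0n.
have l20 : 0 < l2 by exact: lambda2_gt0.
have f2_fun : f2 l2 = normal_pdf 0 (Num.sqrt (l2 / 2)).
  by apply/funext => z; exact: f2_normal_pdf.
apply: (@joint_density_affine_sum _ _ _ _ _ _ _ (chi_pdf (2 * M))
  (normal_pdf 0 (Num.sqrt (l2 / 2)))) => //; rewrite ?f2_fun//.
- exact: measurable_chi_pdf.
- exact: chi_pdf_ge0.
- exact: measurable_normal_pdf.
- exact: normal_pdf_ge0.
- exact: measurable_normal_pdf.
- exact: normal_pdf_ge0.
- by move=> z; exact: f1_convolution.
Qed.
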